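(* Let $\mathbb{F}$ be either the field of real numbers or a finite field in which $-3$ is a quadratic non-residue. For $n\ge 4$ and $2\le d\le n-2$, the elementary symmetric polynomial $S_n^d\in\mathbb{F}[x_1,\ldots,x_n]$ is not expressible as a read-once determinant over $\mathbb{F}$; that is, there is no matrix $M$ (of any size) with entries in $\{x_1,\ldots,x_n\}\cup\mathbb{F}$, in which each variable occurs in at most one position, such that $\det(M)=S_n^d$.
   Context: $S_n^d(x_1,\ldots,x_n)=\sum_{A\subseteq\{1,\ldots,n\},|A|=d}\prod_{i\in A}x_i$. *)

(* Defs.v *)
From HB Require Import structures.
From mathcomp Require Import all_boot all_order all_algebra.
From mathcomp Require Import reals.
From mathcomp Require Import mpoly.

Set Implicit Arguments.
Unset Strict Implicit.
Unset Printing Implicit Defensive.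

Import GRing.Theory.
Local Open Scope ring_scope.

Definition var_or_const (F : fieldType) (n : nat) (p : {mpoly F[n]}) : Prop :=
  (exists i : 'I_n, p = 'X_i) \/ (exists c : F, p = c%:MP).

Definition read_once_matrix (F : fieldType) (n m : nat)
    (M : 'M[{mpoly F[n]}]_m) : Prop :=
  (forall r c : 'I_m, var_or_const (M r c)) /\
  (forall (i : 'I_n) (r c r' c' : 'I_m),
     M r c = 'X_i -> M r' c' = 'X_i -> r = r' /\ c = c').

Definition read_once_determinant (F : fieldType) (n : nat)
    (p : {mpoly F[n]}) : Prop :=
  exists (m : nat) (M : 'M[{mpoly F[n]}]_m),
    read_once_matrix M /\ \det M = p.

(* Zero counts as a square here; this agrees with the usual convention that
   quadratic non-residues are nonzero. *)
Definition quadratic_nonresidue (F : fieldType) (a : F) : Prop :=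
  ~ exists x : F, x ^+ 2 = a.

(* Main.v *)
(* Read-once determinants are closed under partial derivatives and under setting
   variables to 0, which reduces S_n^d to S_4^2 in variables a, b, c, e.  For a
   determinant f in which a and b occur once, the Desnanot-Jacobi identity reads
   f_a f_b - f f_ab = g h, where g and h are minors of the matrix, hence affine
   in c.  For f = S_4^2 the left side is c^2 + c e + e^2, so at e = 1 one gets a
   factorization of c^2 + c + 1 into two affine factors, whose roots give a
   square root of -3. *)
Require Import Defs.
From HB Require Import structures.
From mathcomp Require Import all_boot all_order all_algebra.
From mathcomp Require Import perm.
From mathcomp Require Import reals.
From mathcomp Require Import mpoly.
From mathcomp Require Import ring zify.

Set Implicit Arguments.
Unset Strict Implicit.
Unset Printing Implicit Defensive.

Import GRing.Theory.
Local Open Scope ring_scope.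

(** * Row replacement, cofactors and the Desnanot-Jacobi identity *)

Section SetRow.
Variables (R : comNzRingType) (m : nat).
Implicit Types (A : 'M[R]_m) (u : 'rV[R]_m).

(** With [u] a unit row the determinant becomes a cofactor, while the matrix keeps its size [m]. *)
Definition set_row A i u : 'M[R]_m :=
  \matrix_(k, l) if k == i then u 0 l else A k l.

(** Expansion along row [i], whose cofactors do not see that row. *)
Lemma det_set_row A i u : \det (set_row A i u) = (u *m \adj A) 0 i.
Proof.
rewrite (expand_det_row _ i) mxE; apply: eq_bigr => l _.
rewrite !mxE eqxx; congr (_ * _); rewrite /cofactor; congr (_ * \det _).
by apply/matrixP=> x y; rewrite !mxE eq_sym (negbTE (neq_lift _ _)).
Qed.

Lemma det_set_row_delta A i j : \det (set_row A i (delta_mx 0 j)) = \adj A j i.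
Proof. by rewrite det_set_row -rowE mxE. Qed.

Lemma adj_set_row A i u j : \adj (set_row A i u) j i = \adj A j i.
Proof.
rewrite -!det_set_row_delta; congr (\det _).
by apply/matrixP=> k l; rewrite !mxE; case: (k == i).
Qed.

Lemma add_delta_set_row A t r c :
  A + t *: delta_mx r c = set_row A r (row r A + t *: delta_mx 0 c).
Proof.
apply/matrixP=> k l; rewrite !mxE; case: eqP => [->|_]; first by rewrite eqxx.
by rewrite mulr0 addr0.
Qed.

(** The change is confined to row [r], in which the determinant is linear. Cofactors are thus
    slopes, later read as partial derivatives. *)
Lemma det_add_delta A t r c :
  \det (A + t *: delta_mx r c) = \det A + t * \adj A c r.
Proof.
rewrite add_delta_set_row det_set_row mulmxDl -scalemxAl -rowE -row_mul.
by rewrite mul_mx_adj !mxE eqxx mulr1n.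
Qed.

(* Desnanot-Jacobi (Dodgson) identity.  Expand the determinant with unit rows
   e_c1, e_c2 after writing det A * e_c1 as the combination of the rows of A
   with coefficients from row c1 of the adjugate: only the rows r1 and r2
   contribute. *)
Lemma adj_minor2 A r1 c1 r2 c2 : r1 != r2 ->
  \det A * \adj (set_row A r1 (delta_mx 0 c1)) c2 r2 =
  \adj A c1 r1 * \adj A c2 r2 - \adj A c1 r2 * \adj A c2 r1.
Proof.
move=> ne12; have ne21 : (r2 == r1) = false by rewrite eq_sym (negbTE ne12).
set A2 := set_row A r2 (delta_mx 0 c2).
have -> : \adj (set_row A r1 (delta_mx 0 c1)) c2 r2 =
          \det (set_row A2 r1 (delta_mx 0 c1)).
  rewrite -det_set_row_delta; congr (\det _); apply/matrixP=> k l.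
  rewrite !mxE; case: (k =P r2) => [->|//].
  by rewrite ne21.
have detA_row : row c1 (\adj A) *m A = \det A *: delta_mx 0 c1.
  by rewrite -row_mul mul_adj_mx -scalemx1 linearZ /= row1.
have -> : \det A * \det (set_row A2 r1 (delta_mx 0 c1)) =
          \sum_k \adj A c1 k * \det (set_row A2 r1 (row k A)).
  rewrite det_set_row.
  transitivity (((\det A *: (delta_mx 0 c1 : 'rV_m)) *m \adj A2) 0 r1).
    by rewrite -scalemxAl [RHS]mxE.
  rewrite -detA_row -mulmxA mxE; apply: eq_bigr => k _.
  by rewrite det_set_row -row_mul [row k _ _ _]mxE [row c1 _ _ _]mxE.
(* For any other [k], row [k] of [A] appears twice and the determinant vanishes. *)
rewrite (bigD1 r1) //= (bigD1 r2) 1?eq_sym //= big1 ?addr0; last first.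
  move=> k /andP[k1 k2].
  rewrite (@determinant_alternate _ _ _ r1 k) ?mulr0 1?eq_sym // => l.
  by rewrite !mxE eqxx (negbTE k1) (negbTE k2).
rewrite -mulrN; congr (_ * _ + _ * _).
  rewrite -det_set_row_delta -/A2; congr (\det _); apply/matrixP=> k l.
  by rewrite !mxE; case: (k =P r1) => [->|//]; rewrite (negbTE ne12).
rewrite -det_set_row_delta.
(* The term of [r2] is a cofactor up to a swap of two rows, hence the minus sign. *)
have -> : set_row A2 r1 (row r2 A) =
          xrow r1 r2 (set_row A r1 (delta_mx 0 c2)).
  apply/matrixP=> k l; rewrite !mxE.
  case: tpermP => [->|->|/eqP/negbTE-> /eqP/negbTE->//].
    by rewrite !eqxx ne21.
  by rewrite !eqxx ne21.
by rewrite xrowE det_mulmx det_perm odd_tperm ne12 expr1 mulN1r.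
Qed.

End SetRow.

(** The occurrence pattern of one variable in a read-once matrix. *)
Definition zero_or_delta (R : nzRingType) m (B : 'M[R]_m) :=
  B = 0 \/ exists r c, B = delta_mx r c.

(** An entry of the adjugate is a determinant with one row made a unit row, and ['X] still sits in
    at most one position of it. *)
Lemma size_adj_affine (F : fieldType) m (A : 'M[F]_m) (B : 'M[{poly F}]_m) i j :
  zero_or_delta B -> (size (\adj (map_mx polyC A + 'X *: B) i j) <= 2)%N.
Proof.
rewrite -det_set_row_delta => -[->|[r [c ->]]].
  rewrite scaler0 addr0.
  have -> : set_row (map_mx polyC A) j (delta_mx 0 i) =
            map_mx polyC (set_row A j (delta_mx 0 i)).
    by apply/matrixP=> k l; rewrite !mxE; case: ifP => // _; rewrite polyC_natr.
  rewrite det_map_mx; exact: leq_trans (size_polyC_leq1 _) _.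
(* The unit row erases ['X] exactly when [r = j]. *)
have -> : set_row (map_mx polyC A + 'X *: delta_mx r c) j (delta_mx 0 i) =
          map_mx polyC (set_row A j (delta_mx 0 i)) +
            ((r != j)%:R * 'X) *: delta_mx r c.
  apply/matrixP=> k l; rewrite !mxE; case: (k =P j) => [->|/eqP nkj].
    by case: (r =P j) => [->|/eqP/negbTE nrj];
      rewrite ?mul0r ?addr0 ?polyC_natr // (eq_sym j) nrj mulr0 addr0.
  case: (k =P r) nkj => [-> ->|]; first by rewrite mul1r.
  by rewrite !mulr0.
rewrite det_add_delta det_map_mx -map_mx_adj mxE.
apply: leq_trans (size_polyD _ _) _; rewrite geq_max.
rewrite (leq_trans (size_polyC_leq1 _)) //=.
case: (r != j); rewrite ?mul1r ?mul0r ?size_poly0 //.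
rewrite mulrC mul_polyC; apply: leq_trans (size_scale_leq _ _) _.
by rewrite size_polyX.
Qed.

(** * Read-once determinants under differentiation *)

Section ReadOnce.
Variables (F : fieldType) (n : nat).
Implicit Types (p : {mpoly F[n]}) (U : {set 'I_n}).

Lemma mderivU i j : ('X_j : {mpoly F[n]})^`M(i) = (i == j)%:R.
Proof.
rewrite mderivX mnm1E eq_sym; case: eqP => [->|_]; last by rewrite scale0r.
by rewrite scale1r -mpolyX0; congr 'X_[_]; apply/mnmP=> k; rewrite mnmBE subnn mnm0E.
Qed.

Lemma mpolyXC_neq i (c : F) : 'X_i <> c%:MP_[n].
Proof.
by move/(congr1 (mderiv i)); rewrite mderivU eqxx mderivC => /eqP; rewrite oner_eq0.
Qed.

Lemma var_or_const_bool (b : bool) : var_or_const (b%:R : {mpoly F[n]}).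
Proof. by right; exists b%:R; rewrite rmorph_nat. Qed.

Lemma mderiv_var_or_const i p : var_or_const p -> p^`M(i) = (p == 'X_i)%:R.
Proof.
case=> [[j ->]|[c ->]]; last by rewrite mderivC; case: eqP => // /esym /mpolyXC_neq.
rewrite mderivU; congr (_%:R); congr nat_of_bool; apply/eqP/eqP => [->//|E].
by move: (mderivU i j); rewrite E mderivU eqxx; case: eqP => // _ /eqP; rewrite oner_eq0.
Qed.

Lemma mderiv_det m (A : 'M[{mpoly F[n]}]_m) i :
  (forall k l, (A k l)^`M(i) = 0) -> (\det A)^`M(i) = 0.
Proof.
move=> dA; rewrite raddf_sum big1 // => s _ /=.
have d1 : (1 : {mpoly F[n]})^`M(i) = 0 by rewrite -mpolyC1 mderivC.
rewrite mderivM [X in X * _](_ : _ = 0); last first.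
  by case: (odd_perm s); rewrite ?expr1 ?mderivN d1 ?oppr0.
rewrite mul0r add0r [X in _ * X](_ : _ = 0) ?mulr0 //.
apply: (big_ind (fun p => p^`M(i) = 0)) => // p q dp dq.
by rewrite mderivM dp dq mul0r mulr0 addr0.
Qed.

Lemma var_position m (M : 'M[{mpoly F[n]}]_m) i : read_once_matrix M ->
  (forall r c, (M r c == 'X_i) = false) \/
  exists r0 c0, forall r c, (M r c == 'X_i) = (r == r0) && (c == c0).
Proof.
move=> [_ inj].
case: (pickP (fun rc => M rc.1 rc.2 == 'X_i)) => [[r0 c0] /= /eqP E|none]; last first.
  by left=> r c; exact: none (r, c).
right; exists r0, c0 => r c; apply/eqP/andP => [E'|[/eqP-> /eqP->]//].
by have [-> ->] := inj _ _ _ _ _ E' E; rewrite !eqxx.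
Qed.

(* Replacing the row of an occurrence of [x_i] by the unit row at that position
   differentiates the determinant and keeps the size of the matrix. *)
Lemma read_once_mderiv i p :
  read_once_determinant p -> read_once_determinant (p^`M(i)).
Proof.
move=> [m [M [roM <-]]]; have [voc inj] := roM.
have [none|[r0 [c0 pos]]] := var_position i roM.
  (* The derivative is 0 here. The zero matrix must be nonempty, since the empty determinant is
     1. *)
  exists 1%N, 0; split; last first.
    rewrite det0 mderiv_det // => k l.
    by rewrite mderiv_var_or_const // none.
  split=> [r c|j r c r' c']; rewrite mxE; first exact: (var_or_const_bool false).
  by move/esym; rewrite -(mpolyC0 n) => /mpolyXC_neq.
exists m, (set_row M r0 (delta_mx 0 c0)); split.
  split=> [r c|j r c r' c'].
    by rewrite !mxE; case: ifP => // _; exact: var_or_const_bool.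
  rewrite !mxE; have bX (b : bool) : b%:R <> 'X_j :> {mpoly F[n]}.
    by move/esym; rewrite -mpolyC_nat => /mpolyXC_neq.
  by case: ifP => [_ /bX//|_]; case: ifP => [_ _ /bX//|_]; exact: inj.
(* In the expansion along [r0] no cofactor involves [x_i], and only the entry at [c0] has a nonzero
   derivative. *)
have -> : \det M = \sum_l M r0 l * \adj M l r0.
  by rewrite (expand_det_row _ r0); apply: eq_bigr => l _; rewrite mxE.
rewrite det_set_row_delta raddf_sum (bigD1 c0) //= big1 ?addr0 => [|l nl].
  rewrite mderivM mderiv_var_or_const // pos !eqxx mul1r -det_set_row_delta.
  rewrite [X in _ + _ * X]mderiv_det ?mulr0 ?addr0 ?det_set_row_delta // => k l.
  rewrite !mxE; case: ifP => [_|nk]; first by rewrite -mpolyC_nat mderivC.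
  by rewrite mderiv_var_or_const // pos nk.
rewrite mderivM mderiv_var_or_const // pos (negbTE nl) andbF mul0r add0r.
rewrite -det_set_row_delta mderiv_det ?mulr0 // => k l'.
rewrite !mxE; case: ifP => [_|nk]; first by rewrite -mpolyC_nat mderivC.
by rewrite mderiv_var_or_const // pos nk.
Qed.

(** * Elementary symmetric polynomials in a subset of the variables *)

Definition esym U k : {mpoly F[n]} :=
  \sum_(A : {set 'I_n} | (#|A| == k) && (A \subset U)) \prod_(i in A) 'X_i.

Lemma esymT k : esym setT k = mesym n F k.
Proof. by apply: eq_bigl => A; rewrite subsetT andbT. Qed.

Lemma esym0 U : esym U 0 = 1.
Proof.
rewrite /esym (big_pred1 set0) ?big_set0 // => A /=.
by rewrite cards_eq0; case: eqP => [->|//]; rewrite sub0set.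
Qed.

(** Split the subsets by whether they contain [i]. *)
Lemma esymU1 i U k : i \notin U ->
  esym (i |: U) k.+1 = esym U k.+1 + 'X_i * esym U k.
Proof.
move=> iU; rewrite /esym (bigID (fun A : {set 'I_n} => i \in A)) /= addrC.
congr (_ + _).
  apply: eq_bigl => A; case: (boolP (i \in A)) => iA; rewrite ?andbF ?andbT.
    by symmetry; apply/negbTE/negP=> /andP[_ /subsetP/(_ _ iA)]; rewrite (negbTE iU).
  congr (_ && _); apply/subsetP/subsetP => AU x xA; have := AU x xA.
    by rewrite !inE; case/orP=> // /eqP xi; rewrite -xi xA in iA.
  by rewrite !inE => ->; rewrite orbT.
rewrite mulr_sumr (reindex_onto (fun A => i |: A) (fun A => A :\ i)) /=; last first.
  by move=> A /andP[_ iA]; rewrite setD1K.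
apply: eq_big => A.
  rewrite setU11 andbT; apply/idP/idP => [/andP[/andP[cA AU] /eqP E]|/andP[cA AU]].
    have iA : i \notin A by rewrite -E !inE eqxx.
    move: cA; rewrite cardsU1 iA add1n eqSS => -> /=.
    apply/subsetP=> x xA; have := subsetP AU x; rewrite !inE xA orbT => /(_ isT).
    by case/orP=> // /eqP xi; rewrite -xi xA in iA.
  have iA : i \notin A by apply: contra iU; exact: subsetP.
  by rewrite cardsU1 iA (eqP cA) eqxx setUS // setU1K ?eqxx.
move=> /andP[_ /eqP E].
by rewrite big_setU1 // -E !inE eqxx.
Qed.

Lemma mderiv_esym i U k : i \notin U -> (esym U k)^`M(i) = 0.
Proof.
move=> iU; rewrite raddf_sum big1 // => A /andP[_ AU] /=.
rewrite big_seq_cond; apply: (big_ind (fun p => p^`M(i) = 0)).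
- by rewrite -mpolyC1 mderivC.
- by move=> p q dp dq; rewrite mderivM dp dq mul0r mulr0 addr0.
move=> j /andP[_ jA]; rewrite mderivU; case: eqP => // ij.
by rewrite ij (subsetP AU) in iU.
Qed.

(** Drives the descent to degree 2: a derivative removes a variable without leaving the polynomial
    ring. *)
Lemma mderiv_esymU1 i U k : i \notin U -> (esym (i |: U) k.+1)^`M(i) = esym U k.
Proof.
move=> iU; rewrite esymU1 // mderivD mderivM !mderiv_esym // mderivU eqxx.
by rewrite mul1r mulr0 addr0 add0r.
Qed.

(** * Evaluation at univariate polynomials *)

Lemma mmap_esym0 (v : 'I_n -> {poly F}) U k :
  {in U, forall i, v i = 0} -> mmap polyC v (esym U k.+1) = 0.
Proof.
move=> v0; rewrite raddf_sum big1 // => A /andP[/eqP cA AU] /=.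
have /card_gt0P[i iA] : (0 < #|A|)%N by rewrite cA.
by rewrite (bigD1 i) //= rmorphM /= mmapX mmap1U v0 ?mul0r // (subsetP AU).
Qed.

(** [B] marks the position of [x_i], if any; being chosen before the evaluations, it serves them
    all. *)
Lemma mmap_read_once m (M : 'M[{mpoly F[n]}]_m) i : read_once_matrix M ->
  exists2 B : 'M[{poly F}]_m, zero_or_delta B &
    forall v v' : 'I_n -> {poly F}, (forall j, j != i -> v j = v' j) ->
      map_mx (mmap polyC v') M = map_mx (mmap polyC v) M + (v' i - v i) *: B.
Proof.
move=> roM; have [voc _] := roM.
have E v v' r c : (forall j, j != i -> v j = v' j) ->
  mmap polyC v' (M r c) =
  mmap polyC v (M r c) + (v' i - v i) * (M r c == 'X_i)%:R :> {poly F}.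
  move=> vv'; case: eqP => [->|nXi]; first by rewrite !mmapX !mmap1U mulr1 addrC subrK.
  rewrite mulr0 addr0; case: (voc r c) nXi => [[j ->] nXi|[a ->] _].
    by rewrite !mmapX !mmap1U vv' //; apply/eqP=> ji; rewrite ji in nXi.
  by rewrite !mmapC.
have [none|[r0 [c0 pos]]] := var_position i roM.
  exists 0; first by left.
  by move=> v v' vv'; apply/matrixP=> r c; rewrite !mxE (E v) // none.
exists (delta_mx r0 c0); first by right; exists r0, c0.
by move=> v v' vv'; apply/matrixP=> r c; rewrite !mxE (E v) // pos.
Qed.

(** * Degree two: a factorization and the square root of -3 *)

Lemma factor_X2X1_sqrtN3 (g h : {poly F}) :
  (size g <= 2)%N -> (size h <= 2)%N -> g * h = 'X^2 + 'X + 1 ->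
  exists x : F, x ^+ 2 = - 3%:R.
Proof.
move=> sg sh gh.
have sgh : size (g * h) = 3.
  rewrite gh -addrA size_polyDl ?size_polyXn //.
  by rewrite size_XaddC.
have g0 : g != 0 by apply/eqP=> E; move: sgh; rewrite E mul0r size_poly0.
have h0 : h != 0 by apply/eqP=> E; move: sgh; rewrite E mulr0 size_poly0.
(* Two sizes of at most 2 must add up to 4. *)
have sg2 : size g = 2.
  move: sg sh sgh; rewrite size_mul //.
  by case: (size g) => [|[|[|]]]; case: (size h) => [|[|[|]]].
have [t gt0] : exists t, root g t.
  have g1 : g`_1 != 0 by move: g0; rewrite -lead_coef_eq0 lead_coefE sg2.
  exists (- g`_0 / g`_1); rewrite /root horner_coef sg2 !big_ord_recl big_ord0 /=.
  by apply/eqP; rewrite expr0 /bump /= expr1; field.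
have : root (g * h) t by rewrite rootM gt0.
rewrite gh /root !hornerE => /eqP E.
(* Completing the square: (2t + 1)^2 + 3 = 4(t^2 + t + 1). *)
exists (2%:R * t + 1); apply: subr0_eq; rewrite -[RHS](mulr0 4%:R) -E; ring.
Qed.

(** Variables beyond the chosen four are collected in [W] and evaluated at 0. *)
Lemma read_once_esym2_sqrtN3 (a b c e : 'I_n) (W : {set 'I_n}) :
  uniq [:: a; b; c; e] -> {in W, forall i, i \notin [:: a; b; c; e]} ->
  read_once_determinant (esym (a |: (b |: (c |: (e |: W)))) 2) ->
  exists x : F, x ^+ 2 = - 3%:R.
Proof.
move=> abce WN [m [M [roM detM]]].
move: (abce); rewrite /= !inE !negb_or.
move=> /and4P[/and3P[ab ac ae] /andP[bc be] ce _].
(* Determinants are later taken at [z = 'X], with [x] and [y] in {0, 1}, so that differences give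
   derivatives. *)
pose v (x y z : {poly F}) j :=
  if j == a then x else if j == b then y else if j == c then z
  else if j == e then 1 else 0.
have va x y z : v x y z a = x by rewrite /v eqxx.
have vb x y z : v x y z b = y by rewrite /v eq_sym (negbTE ab) eqxx.
have vc x y z : v x y z c = z.
  by rewrite /v eq_sym (negbTE ac) eq_sym (negbTE bc) eqxx.
have ve x y z : v x y z e = 1.
  by rewrite /v !(eq_sym e) (negbTE ae) (negbTE be) (negbTE ce) eqxx.
have vW x y z : {in W, forall i, v x y z i = 0}.
  move=> i /WN; rewrite !inE !negb_or => /and4P[ia ib ic ie].
  by rewrite /v (negbTE ia) (negbTE ib) (negbTE ic) (negbTE ie).
have aW : a \notin W by apply/negP => /WN; rewrite !inE eqxx.
have bW : b \notin W by apply/negP => /WN; rewrite !inE eqxx !orbT.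
have cW : c \notin W by apply/negP => /WN; rewrite !inE eqxx !orbT.
have eW : e \notin W by apply/negP => /WN; rewrite !inE eqxx !orbT.
pose A x y z := map_mx (mmap polyC (v x y z)) M.
have detA x y z : \det (A x y z) = x * y + (x + y) * (z + 1) + z.
  rewrite /A det_map_mx detM !esymU1 ?esym0 ?inE ?negb_or ?ab ?ac ?ae ?bc ?be ?ce //=.
  rewrite !(rmorphD, rmorphM, rmorph1) /= !mmap_esym0 ?mmapX ?mmap1U //.
  rewrite va vb vc ve; ring.
have [Ba zda Ea] := mmap_read_once a roM.
have [Bb zdb Eb] := mmap_read_once b roM.
have [Bc zdc Ec] := mmap_read_once c roM.
have Aa x y z : A x y z = A 0 y z + x *: Ba.
  rewrite /A (Ea (v 0 y z)) ?va ?subr0 // => j /negbTE ja; by rewrite /v ja.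
have Ab x y z : A x y z = A x 0 z + y *: Bb.
  rewrite /A (Eb (v x 0 z)) ?vb ?subr0 // => j /negbTE jb; by rewrite /v jb.
have [P EP] : exists P : 'M[F]_m, A 0 0 'X = map_mx polyC P + 'X *: Bc.
  (* At [z = 0] all entries are constants, so taking coefficient 0 loses nothing. *)
  exists (map_mx (mmap polyC (v 0 0 0) \; coefp 0) M).
  rewrite /A (Ec (v 0 0 0)) ?vc ?subr0 => [|j /negbTE jc]; last by rewrite /v jc.
  congr (_ + _); apply/matrixP=> r k; rewrite !mxE /=.
  case: (roM.1 r k) => [[j ->]|[x ->]]; last by rewrite mmapC coefC.
  by rewrite mmapX mmap1U /v; do ?[case: ifP => _]; rewrite ?coefC ?coef0 ?coef1.
have X1_neq0 : 'X + 1 != 0 :> {poly F} by rewrite -size_poly_eq0 size_XaddC.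
(* If [x_a] did not occur, the determinants at [x = 0] and [x = 1] would agree; they differ by
   ['X + 1]. *)
case: zda => [Ba0|[ra [ca Bad]]].
  have := detA 1 0 'X; rewrite Aa Ba0 scaler0 addr0 detA => E.
  case/eqP: X1_neq0.
  by transitivity (1 * 0 + (1 + 0) * ('X + 1) + 'X - 'X : {poly F});
    [ring | rewrite -E; ring].
case: zdb => [Bb0|[rb [cb Bbd]]].
  have := detA 0 1 'X; rewrite Ab Bb0 scaler0 addr0 detA => E.
  case/eqP: X1_neq0.
  by transitivity (0 * 1 + (0 + 1) * ('X + 1) + 'X - 'X : {poly F});
    [ring | rewrite -E; ring].
pose Q := A 0 0 'X.
have detQ : \det Q = 'X by rewrite detA; ring.
have adjQa : \adj Q ca ra = 'X + 1.
  have := detA 1 0 'X; rewrite Aa Bad det_add_delta -/Q detQ => E.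
  by apply: (addrI 'X); rewrite -[X in _ + X]mul1r E; ring.
have adjQb : \adj Q cb rb = 'X + 1.
  have := detA 0 1 'X; rewrite Ab Bbd det_add_delta -/Q detQ => E.
  by apply: (addrI 'X); rewrite -[X in _ + X]mul1r E; ring.
have adjQba : \adj (Q + 1 *: delta_mx rb cb) ca ra = 'X + 2%:R.
  have := detA 1 1 'X; rewrite Aa Bad det_add_delta detA Ab Bbd => E.
  by apply: (addrI (\det (A 0 1 'X))); rewrite detA -[X in _ + X]mul1r E; ring.
(* In a common row, the entry of [b] could not affect the cofactor of [a], which goes from ['X + 1]
   to ['X + 2]. *)
have rab : ra != rb.
  apply/eqP=> rab; move: adjQba; rewrite add_delta_set_row -rab adj_set_row adjQa.
  by move/addrI/eqP; rewrite -subr_eq0 (_ : 1 - 2%:R = -1) ?oppr_eq0 ?oner_eq0 //; ring.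
have := adj_minor2 Q ca cb rab.
(* This is f_ab, the change of the cofactor of [a] as [y] goes from 0 to 1. *)
have -> : \adj (set_row Q ra (delta_mx 0 ca)) cb rb = 1.
  move: adjQba; rewrite -(det_set_row_delta _ ra ca).
  have -> : set_row (Q + 1 *: delta_mx rb cb) ra (delta_mx 0 ca) =
            set_row Q ra (delta_mx 0 ca) + 1 *: delta_mx rb cb.
    apply/matrixP=> k l; rewrite !mxE; case: (k =P ra) => // ->.
    by rewrite (negbTE rab) mulr0 addr0.
  rewrite det_add_delta det_set_row_delta adjQa mul1r => E.
  by apply: (addrI ('X + 1)); rewrite E; ring.
rewrite detQ adjQa adjQb => minorQ.
(* The cross cofactors are the factors, with product [('X + 1) * ('X + 1) - 'X]. *)
apply: (@factor_X2X1_sqrtN3 (\adj Q ca rb) (\adj Q cb ra)).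
- by rewrite /Q EP size_adj_affine.
- by rewrite /Q EP size_adj_affine.
apply: oppr_inj; apply: (addrI (('X + 1) * ('X + 1))).
by rewrite -minorQ; ring.
Qed.

(** * Descent to degree two and conclusion *)

Lemma read_once_esym_sqrtN3 k U : (k + 4 <= #|U|)%N ->
  read_once_determinant (esym U k.+2) -> exists x : F, x ^+ 2 = - 3%:R.
Proof.
elim: k U => [|k IHk] U cU roU; last first.
  (* Differentiating in any variable of [U] lowers [k] and the size of [U] by one each, so the bound
     persists. *)
  have /card_gt0P[i iU] : (0 < #|U|)%N by apply: leq_trans cU.
  apply: (IHk (U :\ i)); first by move: cU; rewrite (cardsD1 i) iU.
  by rewrite -(@mderiv_esymU1 i) ?setD1K ?setD11 //; exact: read_once_mderiv.
have := enum_uniq U; have := mem_enum U; move: cU; rewrite cardE.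
case: (enum U) => [|a [|b [|c [|e s]]]] // _ memU uniqU.
pose W := U :\: [set x in [:: a; b; c; e]].
apply: (@read_once_esym2_sqrtN3 a b c e W).
- by move: uniqU; rewrite -[_ :: _]/([:: a; b; c; e] ++ s) cat_uniq => /andP[].
- by move=> i; rewrite !inE => /andP[].
suff <- : U = a |: (b |: (c |: (e |: W))) by [].
apply/setP=> x; rewrite -memU !inE -memU !inE.
by do 4![case: (x == _) => //=].
Qed.

Lemma read_once_mesym_sqrtN3 d : (4 <= n)%N -> (2 <= d)%N -> (d <= n - 2)%N ->
  read_once_determinant (mesym n F d) -> exists x : F, x ^+ 2 = - 3%:R.
Proof.
case: d => [|[|k]] // n4 _ dn; rewrite -esymT; apply: read_once_esym_sqrtN3.
by rewrite cardsT card_ord; lia.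
Qed.

End ReadOnce.

Theorem theorem5 :
  (forall (R : realType) (n d : nat),
     (4 <= n)%N -> (2 <= d)%N -> (d <= n - 2)%N ->
     ~ read_once_determinant (mesym n R d))
  /\
  (forall (F : finFieldType),
     quadratic_nonresidue (- 3%:R : F) ->
     forall n d : nat,
     (4 <= n)%N -> (2 <= d)%N -> (d <= n - 2)%N ->
     ~ read_once_determinant (mesym n F d)).
Proof.
split=> [R n d n4 d2 dn ro|F nr n d n4 d2 dn ro]; last first.
  exact/nr/(read_once_mesym_sqrtN3 n4 d2 dn ro).
have [x x2] := read_once_mesym_sqrtN3 n4 d2 dn ro.
(* Over the reals a square is nonnegative, and -3 is not. *)
by have := Num.Theory.sqr_ge0 x; rewrite x2 Num.Theory.oppr_ge0 Num.Theory.lern0.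
Qed.
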